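(* For a finite bipartite graph $G$ (with bipartition $(X,Y)$) the following are equivalent: (i) $G$ is a cocomparability bigraph; (ii) $\overline{G}$ has an acyclic $T$-free orientation; (iii) $\overline{G}$ has a $T$-free orientation; (iv) $G$ does not contain an invertible pair; (v) $G$ does not contain a weak edge-asteroid; (vi) $G$ does not contain an edge-asteroid; (vii) $I(G)$ is a comparability graph.
   Context: $G$ is a cocomparability bigraph if there exist linear orderings $\prec_X$ of $X$ and $\prec_Y$ of $Y$ such that for all $u,v\in X$, $w,z\in Y$ with $u\prec_X v$, $w\prec_Y z$ and $uz,vw\in E(G)$, at least one of $uw,vz$ is in $E(G)$. Two edges $xy,x'y'$ ($x,x'\in X$, $y,y'\in Y$) are independent if they are disjoint and $xy'\notin E(G)$, $x'y\notin E(G)$. $I(G)$ has vertex set $E(G)$, two edges adjacent iff independent; a comparability graph is one admitting a transitive orientation. An orientation of the complement $\overline{G}$ is a mixed graph in which every non-edge $xy$ of $G$ with $x\in X,y\in Y$ is an undirected edge and every pair of distinct vertices both in $X$ or both in $Y$ is oriented in exactly one direction; it is acyclic if it has no directed cycle, and $T$-free if there are no $x,x'\in X$, $y,y'\in Y$ with $xy,x'y'\notin E(G)$, $xy',x'y\in E(G)$, and arcs $x\to x'$, $y\to y'$. Two walks $a_1\dots a_k$, $b_1\dots b_k$ with $a_1,b_1$ in the same part are congruent if for each $i$ the edges $a_ia_{i+1}$, $b_ib_{i+1}$ are independent; $u,v$ is an invertible pair if there are congruent walks from $u$ to $v$ and from $v$ to $u$. An edge-asteroid is a set of $2k+1$ ($k\ge1$)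 distinct edges $e_0,\dots,e_{2k}$ such that for each $i$ there is a walk containing both end vertices of $e_{i+k}$ and both end vertices of $e_{i+k+1}$ and no vertex adjacent to an end vertex of $e_i$ (indices mod $2k+1$); a weak edge-asteroid is the same without requiring the edges to be distinct. *)

(* Defs.v *)
From mathcomp Require Import all_boot zmodp.
Set Implicit Arguments.
Unset Strict Implicit.
Unset Printing Implicit Defensive.

Definition strict_linear_order_on (V : finType) (A : {set V}) (lt : rel V) : Prop :=
  [/\ {in A, irreflexive lt},
      {in A & &, transitive lt}
    & {in A &, forall u v, u != v -> lt u v || lt v u}].

Definition comparability_graph (V : finType) (adj : rel V) : Prop :=
  exists A : rel V,
    [/\ forall u v, adj u v = A u v || A v u,
        forall u v, ~~ (A u v && A v u)
      & transitive A].

Record mixed_graph (V : finType) := MixedGraph {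
  uedge : rel V;
  arc : rel V
}.

(* Only arcs take part in directed cycles. *)
Definition acyclic (V : finType) (M : mixed_graph V) : Prop :=
  ~ exists c : seq V, [&& c != [::], uniq c & cycle (arc M) c].

Section Bigraph.

Variables (V : finType) (adj : rel V) (X Y : {set V}).

(* Loops are excluded, since X and Y are disjoint. *)
Definition bipartite_graph : Prop :=
  [/\ symmetric adj,
      X :|: Y = [set: V],
      [disjoint X & Y]
    & forall u v, adj u v ->
        (u \in X) && (v \in Y) || (u \in Y) && (v \in X)].

Definition same_part (u v : V) : bool :=
  (u \in X) && (v \in X) || (u \in Y) && (v \in Y).

Definition cocomparability_bigraph : Prop :=
  exists ltX ltY : rel V,
    [/\ strict_linear_order_on X ltX,
        strict_linear_order_on Y ltY
      & forall u v w z, u \in X -> v \in X -> w \in Y -> z \in Y ->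
          ltX u v -> ltY w z -> adj u z -> adj v w -> adj u w || adj v z].

Definition complement_orientation (M : mixed_graph V) : Prop :=
  [/\ forall u v, uedge M u v = ~~ same_part u v && ~~ adj u v,
      forall u v, arc M u v || arc M v u = (u != v) && same_part u v
    & forall u v, ~~ (arc M u v && arc M v u)].

Definition T_free (M : mixed_graph V) : Prop :=
  ~ exists x x' y y' : V,
      [/\ [&& x \in X, x' \in X, y \in Y & y' \in Y],
          ~~ adj x y /\ ~~ adj x' y',
          adj x y' /\ adj x' y
        & arc M x x' /\ arc M y y'].

Definition edges : {set {set V}} :=
  [set [set x; y] | x in X, y in Y & adj x y].

Definition independent (f g : {set V}) : bool :=
  [&& [disjoint f & g],
      [forall x in f :&: X, forall y' in g :&: Y, ~~ adj x y']
    & [forall x' in g :&: X, forall y in f :&: Y, ~~ adj x' y]].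

(* The graph I(G) *)
Definition edge_graph : rel {f : {set V} | f \in edges} :=
  fun f g => independent (val f) (val g).

Definition is_walk (w : seq V) : bool := (w != [::]) && sorted adj w.

Definition walk_edges (w : seq V) : seq {set V} :=
  if w is u :: p then pairmap (fun a b => [set a; b]) u p else [::].

(* The size test accounts for the empty and one-vertex walks, which have the
   same edges. *)
Definition congruent (a b : seq V) : bool :=
  [&& size a == size b,
      (if (a, b) is (u :: _, v :: _) then same_part u v else false)
    & all2 independent (walk_edges a) (walk_edges b)].

Definition walk_from_to (u v : V) (w : seq V) : bool :=
  [&& is_walk w, head v w == u & last u w == v].

(* The vertices of a pair are distinct: otherwise the one-vertex walk at u,
   which is congruent to itself, would make u, u an invertible pair. *)
Definition invertible_pair (u v : V) : Prop :=
  u != v /\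
  exists a b : seq V, [/\ walk_from_to u v a, walk_from_to v u b & congruent a b].

(* inZp reduces its argument modulo 2k+1. *)
Definition weak_edge_asteroid (k : nat) (e : 'I_(k.*2.+1) -> {set V}) : Prop :=
  [/\ 0 < k,
      forall i, e i \in edges
    & forall i : 'I_(k.*2.+1), exists w : seq V,
        [/\ is_walk w,
            {subset e (inZp (i + k)) <= w},
            {subset e (inZp (i + k + 1)) <= w}
          & {in w & e i, forall z v, ~~ adj z v}]].

Definition edge_asteroid (k : nat) (e : 'I_(k.*2.+1) -> {set V}) : Prop :=
  weak_edge_asteroid e /\ injective e.

End Bigraph.

Arguments edge_graph {V} adj X Y f g.

(* Main.v *)
(* Let I be the independence relation on edges, and let the knotting graph of
   Gallai have as nodes the pairs (e, C) with C a class of I-neighbours of e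
   connected through non-I steps; (e, C) and (f, D) are adjacent when f is in C
   and e is in D.
   A transitive orientation of I is constant on each class, so it 2-colours the
   knotting graph; odd cycles of the knotting graph are weak edge-asteroids in
   another order, and an invertible pair produces one.
   In a shortest odd cycle no edge occurs twice: if v occurs with two classes,
   either one occurrence can be replaced by a cycle neighbour of the other, which
   brings two equal edges closer together, or both classes are attached to v through
   one and the same set of vertices, which gives a shorter odd cycle. Hence
   edge-asteroids can be taken with distinct edges.
   Without invertible pairs, vertices of a part are ordered by inclusion of
   neighbourhoods and, when these are incomparable, by the lexicographically
   least pair, its leader, in the class of the forcing relation. In a directed
   triangle all pairs are incomparable, and an arc can be moved within its class
   together with the whole triangle. Move an arc to the least leader (u, v) that
   occurs: the arc from the third vertex w into u then has a leader starting at
   u, and moving it there reverses the arc uv. *)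
Require Import Defs.
From mathcomp Require Import all_boot zmodp.

Set Implicit Arguments.
Unset Strict Implicit.
Unset Printing Implicit Defensive.

(** * Odd cycles of the knotting graph *)

Section Knotting.

Variables (T : finType) (H : rel T).
Hypotheses (Hsym : symmetric H) (Hirr : irreflexive H).

Definition conn (e f g : T) : bool :=
  H e f && connect [rel x y | [&& H e x, H e y & ~~ H x y]] f g.

Lemma connHl e f g : conn e f g -> H e f.
Proof. by case/andP. Qed.

Lemma conn_refl e f : H e f -> conn e f f.
Proof. by move=> ef; rewrite /conn ef connect0. Qed.

Lemma conn_trans e f g h : conn e f g -> conn e g h -> conn e f h.
Proof.
by case/andP=> ef fg /andP[_ gh]; rewrite /conn ef (connect_trans fg gh).
Qed.

Lemma conn1 e f g : H e f -> H e g -> ~~ H f g -> conn e f g.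
Proof.
by move=> ef eg fg; rewrite /conn ef connect1 //= ef eg.
Qed.

Lemma conn_rect e f (P : T -> Prop) :
  P f ->
  (forall x y, conn e f x -> P x -> H e y -> ~~ H x y -> P y) ->
  forall g, conn e f g -> P g.
Proof.
move=> Pf step g /andP[ef /connectP[s]].
elim/last_ind: s g => [|s y IH] g /=; first by move=> _ ->.
rewrite rcons_path last_rcons => /andP[sp /and3P[ex ey xy]] ->.
apply: (step (last f s)) => //; last exact: IH.
by rewrite /conn ef; apply/connectP; exists s.
Qed.

Lemma connHr e f g : conn e f g -> H e g.
Proof.
move=> fg; have ef := connHl fg.
by apply: (conn_rect (P := fun x => H e x)) fg.
Qed.

Lemma conn_sym e f g : conn e f g -> conn e g f.
Proof.
move=> fg; have ef := connHl fg.
apply: (conn_rect (P := fun x => conn e x f)) fg; first exact: conn_refl.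
move=> x y _ xf ey xy; apply: (conn_trans _ xf).
by apply: conn1 => //; [exact: connHl xf | rewrite Hsym].
Qed.

(** The steps that connect a class do not mention [e], so the class of [f] at [e] stays connected at
    every [e'] adjacent to all of it. *)
Lemma conn_transfer e e' f g :
  (forall x, conn e f x -> H e' x) -> conn e f g -> conn e' f g.
Proof.
move=> sub fg; have ef := connHl fg.
have e'f : H e' f by apply: sub; apply: conn_refl.
apply: (conn_rect (P := fun x => conn e' f x)) fg; first exact: conn_refl.
move=> x y fx e'fx ey xy; apply: (conn_trans e'fx).
have fy : conn e f y by apply: (conn_trans fx); apply: conn1 => //; apply: connHr fx.
by apply: conn1 => //; apply: sub.
Qed.

(** A missing edge between two classes at [e] would be a step that merges them. *)
Lemma conn_separated e p q x y :
  ~~ conn e p q -> conn e p x -> conn e q y -> H x y.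
Proof.
move=> npq px qy; apply: contraNT npq => nxy.
apply: (conn_trans px); apply: (conn_trans _ (conn_sym qy)).
by apply: conn1 => //; [exact: connHr px | exact: connHr qy].
Qed.

(* The node (e, p) stands for e together with the class of p under [conn e]. *)
Definition knot : rel (T * T) :=
  fun m n => conn m.1 m.2 n.1 && conn n.1 m.1 n.2.

Lemma knot_sym : symmetric knot.
Proof.
suff imp m n : knot m n -> knot n m by move=> m n; apply/idP/idP; apply: imp.
by case/andP=> a b; rewrite /knot (conn_sym a) (conn_sym b).
Qed.

Definition odd_knot_cycle (s : seq (T * T)) : bool := odd (size s) && cycle knot s.

Definition shortest_odd_knot_cycle (s : seq (T * T)) : Prop :=
  odd_knot_cycle s /\ forall s', odd_knot_cycle s' -> size s <= size s'.

Lemma cycle_split (x y : T * T) s1 s2 :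
  cycle knot (x :: s1 ++ y :: s2) =
  [&& path knot x s1, knot (last x s1) y, path knot y s2 & knot (last y s2) x].
Proof. by rewrite /= rcons_cat cat_path /= rcons_path !andbA. Qed.

Lemma knot_neq x y : knot x y -> x.1 != y.1.
Proof.
case/andP=> _ /connHl; apply: contraTneq => ->; by rewrite Hirr.
Qed.

(** * A vertex occurring twice in a shortest odd cycle *)

Section Repetition.

Variables (v p q : T) (s1 s2 : seq (T * T)).
Hypothesis short : shortest_odd_knot_cycle ((v, p) :: s1 ++ (v, q) :: s2).

Let cyc : cycle knot ((v, p) :: s1 ++ (v, q) :: s2).
Proof. by case: short => /andP[]. Qed.

Let parity : odd (size s1 + size s2).
Proof.
by case: short => /andP[]; rewrite /= size_cat /= addnS /= negbK.
Qed.

Lemma shortest_bound s' :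
  odd_knot_cycle s' -> size s1 + size s2 + 2 <= size s'.
Proof.
by case: short => _ min /min; rewrite /= size_cat /= addnS addn2.
Qed.

(** As [size s1 + size s2] is odd, one of the two cycles has odd length, and it is shorter than a
    shortest one. *)
Lemma no_split x y : cycle knot (x :: s1) -> cycle knot (y :: s2) -> False.
Proof.
move=> c1 c2; have := parity; rewrite oddD; case o1 : (odd (size s1)) => /= o2.
  have /shortest_bound : odd_knot_cycle (y :: s2) by rewrite /odd_knot_cycle c2 /= o2.
  by rewrite /= addn2 ltnS ltnNge leq_addl.
have /shortest_bound : odd_knot_cycle (x :: s1) by rewrite /odd_knot_cycle c1 /= o1.
by rewrite /= addn2 ltnS ltnNge leq_addr.
Qed.

(** Otherwise the cycle would split at its two visits to [v]. *)
Lemma knots_differ : ~~ conn v p q.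
Proof.
apply/negP => pq.
have := cyc; rewrite cycle_split => /and4P[p1 l1 p2 l2].
apply: (@no_split (v, p) (v, q)); rewrite /= rcons_path ?p1 ?p2.
  case/andP: l1 => /= a b.
  by rewrite /knot a /=; apply: conn_trans b (conn_sym pq).
case/andP: l2 => /= a b.
by rewrite /knot a /=; apply: conn_trans b pq.
Qed.

(* The separator of v consists of the vertices s that are not H-adjacent to v
   but touch the class of p. The hypotheses on a and y make it equal to the
   analogous set for q and force it to avoid a and y as well, so that the class
   of v at a is seen in the same way from both classes at v. *)
Lemma no_double_separation a pa t y :
  s1 = (a, pa) :: t -> ~~ conn a v q -> conn v q y -> ~~ conn y v p -> False.
Proof.
move=> Es1 nP qy nQ.
have := cyc; rewrite cycle_split => /and4P[p1 l1 p2 l2].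
have npq := knots_differ.
have nqp : ~~ conn v q p by apply: contra npq => /conn_sym.
have [pa1 va] : conn v p a /\ conn a v pa.
  by move: p1; rewrite Es1 /= => /andP[/andP[]].
have vq : H v q by apply: connHl qy.
have vp : H v p by apply: connHl pa1.
(* If [s] were adjacent to [a], the steps from [v] to [s], to [x] and on to [q] would stay among
   neighbours of [a], against [nP]. *)
have sepq s x : ~~ H s v -> conn v q x -> ~~ H s x -> ~~ H s a.
  move=> sv qx sx; apply: contra nP => sa.
  have asx : conn a s x.
    apply: conn1 => //; first by rewrite Hsym.
    exact: conn_separated npq pa1 qx.
  apply: (@conn_trans _ _ s).
    by apply: conn1; rewrite ?(Hsym v s) // Hsym //; apply: connHr pa1.
  apply: (conn_trans asx); apply: conn_sym.
  by apply: (@conn_transfer v) qx => w; apply: conn_separated pa1.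
have sepp s x : ~~ H s v -> conn v p x -> ~~ H s x -> ~~ H s y.
  move=> sv px sx; apply: contra nQ => sy.
  have ysx : conn y s x.
    apply: conn1 => //; first by rewrite Hsym.
    exact: conn_separated nqp qy px.
  apply: (@conn_trans _ _ s).
    by apply: conn1; rewrite ?(Hsym v s) // Hsym //; apply: connHr qy.
  apply: (conn_trans ysx); apply: conn_sym.
  by apply: (@conn_transfer v) px => w; apply: conn_separated qy.
(* A vertex [u] missing some [w] is adjacent to [v] by [sepq] and [sepp], so it joins the class of
   [w] at [v]; the induction hypothesis then contradicts the step from [x] to [u]. *)
have complete u w : conn a v u -> conn v p w || conn v q w -> H u w.
  move=> vu; move: u vu w.
  apply: conn_rect => [w|x u vx IH au xu w].
    by case/orP => /connHr.
  have nua : ~~ ~~ H u a by rewrite negbK Hsym.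
  have vu_of z : conn v p z || conn v q z -> ~~ H u z -> H v u.
    move=> pqz uz; apply: contraNT nua => vu; rewrite Hsym in vu.
    case/orP: pqz => [pz|qz]; last exact: sepq uz.
    by apply: (sepq u y) => //; apply: sepp uz.
  move=> pqw; apply: contraNT xu => uw; apply: IH.
  have vu := vu_of _ pqw uw.
  by case/orP: pqw => c; apply/orP; [left|right]; apply: (conn_trans c);
    apply: conn1 => //; rewrite ?(Hsym w u) //; apply: connHr c.
have seen u w : conn a v u -> conn v p w || conn v q w -> conn w v u.
  move=> vu pqw; apply: (@conn_transfer a) vu => x vx.
  by rewrite Hsym; apply: complete.
have sz := size_cat s1 ((v, q) :: s2).
have sz_odd : odd (size s1 + size s2) && (1 < size s1 + size s2).
  rewrite parity Es1 /= addSn ltnS; case: (s2) l2 => [/knot_neq|]; first by rewrite eqxx.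
  by move=> *; rewrite addnS.
rewrite /= addnS in sz.
case Et: (s1 ++ (v, q) :: s2) sz => [|n1 [|[u pu] [|[w pw0] r]]] //= sz.
  by case: sz sz_odd => <-.
  by case: sz sz_odd => <-.
have En1 : n1 = (a, pa) by move: Et; rewrite Es1 => -[].
have := cyc; rewrite Et En1 /= => /and4P[_ /andP[/= pau apu] /andP[/= puw wpw] cr].
have vu : conn a v u := conn_trans va pau.
(* A neighbour [s] of [u] in the separator merges the two classes at [u], through [x], [s] and [y].
   Then [u] replaces [v] at both visits, and the cycle splits. *)
case: (boolP [exists s, [&& H s u, ~~ H s v & [exists x, conn v p x && ~~ H s x]]]).
  case/existsP => s /and3P[su sv /existsP[x /andP[px sx]]].
  have sy := sepp _ _ sv px sx.
  have connp z : conn v p z -> conn u p z.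
    by apply: conn_transfer => d pd; apply: complete; rewrite ?pd.
  have connq z : conn v q z -> conn u q z.
    by apply: conn_transfer => d qd; apply: complete; rewrite ?qd ?orbT.
  have upq : conn u p q.
    apply: (@conn_trans _ _ x); first exact: connp.
    apply: (@conn_trans _ _ s).
      have us : H u s by rewrite Hsym.
      by apply: conn1 => //; [apply: complete; rewrite ?px | rewrite Hsym].
    apply: (@conn_trans _ _ y); last exact/conn_sym/connq.
    have us : H u s by rewrite Hsym.
    by apply: conn1 => //; apply: complete; rewrite ?qy ?orbT.
  have all_at_u z : conn v p z || conn v q z -> conn u p z.
    by case/orP => [/connp //|/connq]; apply: conn_trans.
  have replace pn n : conn v p pn || conn v q pn -> knot (v, pn) n ->
      knot (u, p) n && knot (u, q) n.
    move=> pqn /andP[/= c1 c2].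
    have pqn1 : conn v p n.1 || conn v q n.1.
      by case/orP: pqn => c; apply/orP; [left|right]; apply: (conn_trans c).
    have un : conn n.1 u n.2 := conn_trans (conn_sym (seen _ _ vu pqn1)) c2.
    have pn1 := all_at_u _ pqn1.
    by rewrite /knot /= un pn1 (conn_trans (conn_sym upq) pn1).
  have replace_p n : knot (v, p) n -> knot (u, p) n && knot (u, q) n.
    by apply: replace; rewrite conn_refl.
  have replace_q n : knot (v, q) n -> knot (u, p) n && knot (u, q) n.
    by apply: replace; rewrite conn_refl ?orbT.
  have c1 : cycle knot ((u, p) :: s1).
    rewrite /= rcons_path; apply/andP; split.
      move: p1; rewrite Es1 /= => /andP[/replace_p/andP[-> _] ->] //.
    have -> : last (u, p) s1 = last (v, p) s1 by rewrite Es1.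
    by rewrite knot_sym; move: l1; rewrite knot_sym => /replace_q/andP[].
  have c2 : cycle knot ((u, q) :: s2).
    case Es2: s2 p2 l2 => [|[c pc] s3] /= p2 l2.
      by move/knot_neq: l2; rewrite eqxx.
    case/andP: p2 => /replace_q/andP[_ k] p2.
    rewrite rcons_path k p2 /=.
    by rewrite knot_sym; move: l2; rewrite knot_sym => /replace_p/andP[].
  exact: (no_split c1 c2).
move/existsPn => noS.
(* Without such [s], the steps from [a] to [w] at [u] never leave the class of [p] at [v]. So
   [(w, pw0)] can follow [(v, p)] directly, and the cycle loses two nodes. *)
have pw : conn v p w.
  apply: (conn_rect (P := fun z => conn v p z)) (conn_trans apu puw) => // x y' _ px uy' xy'.
  case vy' : (H v y').
    by apply: (conn_trans px); apply: conn1 => //; apply: connHr px.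
  move: (noS y'); rewrite Hsym uy' Hsym vy' /=; move/existsPn/(_ x).
  by rewrite px Hsym xy'.
have wseen : conn w v u by apply: seen; rewrite ?pw.
move: cr; rewrite rcons_path => /andP[cr1 cr2].
have : odd_knot_cycle ((v, p) :: (w, pw0) :: r).
  rewrite /odd_knot_cycle /= rcons_path cr1 cr2 andbT /knot /= pw (conn_trans wseen wpw) !andbT.
  by case: sz sz_odd => <- /=; rewrite negbK => /andP[].
by move/shortest_bound; case: sz => <-; rewrite /= addn2 ltnNge leqnSn.
Qed.

End Repetition.

(** * Removing repetitions from odd cycles *)

Lemma shortest_eq s s' :
  size s' = size s -> cycle knot s' -> shortest_odd_knot_cycle s ->
  shortest_odd_knot_cycle s'.
Proof.
by move=> sz cs' [/andP[os _] min]; split; rewrite ?sz // /odd_knot_cycle sz os.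
Qed.

Lemma shortest_rot n s : shortest_odd_knot_cycle s -> shortest_odd_knot_cycle (rot n s).
Proof.
move=> sh; apply: (shortest_eq _ _ sh); first by rewrite size_rot.
by rewrite rot_cycle; case: sh => /andP[].
Qed.

Lemma shortest_rev x s :
  shortest_odd_knot_cycle (x :: s) -> shortest_odd_knot_cycle (x :: rev s).
Proof.
move=> sh; apply: (shortest_eq _ _ sh); first by rewrite /= size_rev.
rewrite -rotr1_rcons rotr_cycle -rev_cons rev_cycle (eq_cycle (e' := knot)) //.
  by case: sh => /andP[].
by move=> m n; rewrite knot_sym.
Qed.

Lemma smaller_gap v p q s1 s2 :
  shortest_odd_knot_cycle ((v, p) :: s1 ++ (v, q) :: s2) ->
  exists v' p' q' s1' s2',
    shortest_odd_knot_cycle ((v', p') :: s1' ++ (v', q') :: s2') /\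
    size s1' < size s1.
Proof.
move=> sh; have npq := knots_differ sh.
have nqp : ~~ conn v q p by apply: contra npq => /conn_sym.
have := sh.1 => /andP[_]; rewrite cycle_split => /and4P[].
case Es1: s1 => [|[a pa] t1] p1 l1; first by move/knot_neq: l1; rewrite eqxx.
case Es2: s2 => [|[c pc] t2] p2 l2; first by move/knot_neq: l2; rewrite eqxx.
have Er1 : (a, pa) :: t1 = rcons (belast (a, pa) t1) (last (a, pa) t1) by rewrite lastI.
have Er2 : (c, pc) :: t2 = rcons (belast (c, pc) t2) (last (c, pc) t2) by rewrite lastI.
move: Er1 Er2 l1 l2; rewrite [last _ (_ :: t1)]/= [last _ (_ :: t2)]/=.
case El1: (last _ t1) => [b pb]; case El2: (last _ t2) => [z pz].
set r1 := belast _ t1; set r2 := belast _ t2 => Er1 Er2.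
case/andP=> /= bv qb; move/conn_sym: qb => qb.
case/andP=> /= zv pz'; move/conn_sym: pz' => pz'.
case/andP: (p1) => /andP[/= pa1 va] p1'.
case/andP: (p2) => /andP[/= qc vc] p2'.
have tq x y1 y2 : conn v p x -> conn v q y1 -> conn v q y2 -> conn x y1 y2.
  move=> px qy1 qy2; apply: (@conn_transfer v) (conn_trans (conn_sym qy1) qy2) => w y1w.
  by apply: (conn_separated npq px); apply: conn_trans y1w.
have tp y x1 x2 : conn v q y -> conn v p x1 -> conn v p x2 -> conn y x1 x2.
  move=> qy px1 px2; apply: (@conn_transfer v) (conn_trans (conn_sym px1) px2) => w x1w.
  by apply: (conn_separated nqp qy); apply: conn_trans x1w.
have vp : conn v p p by apply/conn_refl/(connHl pa1).
have vq : conn v q q by apply/conn_refl/(connHl qc).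
(* The cycle neighbours of [(v, p)] are [a] and [z], those of [(v, q)] are [b] and [c]. If [a] and
   [z] see [v] in the class of [q], which contains [b], then [b] can replace [v] in [(v, p)], and it
   occurs again at the end of [s1]. *)
case: (boolP (conn a v q && conn z v q)) => [/andP[Pa Pz]|NP].
  exists b, p, pb, r1, ((v, q) :: s2).
  have Er : (b, p) :: r1 ++ (b, pb) :: (v, q) :: s2 = (b, p) :: s1 ++ (v, q) :: s2.
    by rewrite Es1 Er1 cat_rcons.
  rewrite Er; split; last by rewrite size_belast.
  apply: (shortest_eq _ _ sh) => //.
  rewrite cycle_split Es1 Es2; apply/and4P; split.
  - apply/andP; split; last exact: p1'.
    rewrite /knot /=; apply/andP; split; first exact: tp vp pa1.
    exact: conn_trans (conn_trans (tq _ _ _ pa1 qb vq) (conn_sym Pa)) va.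
  - by rewrite /= El1 /knot /= bv conn_sym.
  - exact: p2.
  - rewrite /= El2 /knot /=; apply/andP; split; last exact: tp pz' vp.
    exact: conn_trans zv (conn_trans Pz (tq _ _ _ pz' vq qb)).
(* Dually, [a] can replace [v] in [(v, q)]. *)
case: (boolP (conn b v p && conn c v p)) => [/andP[Qb Qc]|NQ].
  exists a, pa, q, t1, (s2 ++ [:: (v, p)]).
  split=> //.
  have Er : (a, pa) :: t1 ++ (a, q) :: (s2 ++ [:: (v, p)]) =
            rot 1 ((v, p) :: s1 ++ (a, q) :: s2).
    by rewrite rot1_cons Es1 /= -cats1 -catA.
  rewrite Er; apply: shortest_rot; apply: (shortest_eq _ _ sh).
    by rewrite /= !size_cat.
  rewrite cycle_split Es1 Es2; apply/and4P; split.
  - exact: p1.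
  - rewrite /= El1 /knot /=; apply/andP; split; last exact: tq pa1 qb vq.
    exact: conn_trans bv (conn_trans Qb (tp _ _ _ qb vp pa1)).
  - apply/andP; split; last exact: p2'.
    rewrite /knot /=; apply/andP; split; first exact: tq pa1 vq qc.
    exact: conn_trans (tp _ _ _ qc pa1 vp) (conn_trans (conn_sym Qc) vc).
  - by rewrite /= El2 /knot /= zv conn_sym.
exfalso.
have sepa y : ~~ conn a v q -> conn v q y -> ~~ conn y v p -> False.
  by move=> nP qy nQ; apply: (no_double_separation sh Es1 nP qy nQ).
(* Reversing the cycle brings [z] into the position of [a]. *)
have sepz y : ~~ conn z v q -> conn v q y -> ~~ conn y v p -> False.
  have := shortest_rev sh; rewrite rev_cat rev_cons cat_rcons => shr.
  have Er : rev s2 = (z, pz) :: rev r2 by rewrite Es2 Er2 rev_rcons.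
  by move=> nP qy nQ; apply: (no_double_separation shr Er nP qy nQ).
by case/nandP: NP => nP; case/nandP: NQ => nQ;
  [exact: (sepa _ nP qb nQ) | exact: (sepa _ nP qc nQ)
  |exact: (sepz _ nP qb nQ) | exact: (sepz _ nP qc nQ)].
Qed.

(** Descent on the gap [size s1], which [smaller_gap] decreases. *)
Lemma no_repetition n v p q s1 s2 :
  size s1 < n -> ~ shortest_odd_knot_cycle ((v, p) :: s1 ++ (v, q) :: s2).
Proof.
elim: n v p q s1 s2 => // n IH v p q s1 s2 lt_n /smaller_gap.
move=> [v' [p' [q' [s1' [s2' [sh lt1]]]]]].
by apply: IH sh; apply: leq_trans lt1 _.
Qed.

Lemma shortest_uniq s : shortest_odd_knot_cycle s -> uniq [seq m.1 | m <- s].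
Proof.
move=> sh; have : forall s1 s2, s1 ++ s2 = s -> uniq [seq m.1 | m <- s2]; last first.
  by apply; exact: (cat0s s).
move=> s1 s2; elim: s2 s1 => //= [[v p]] s2 IH s1 Es.
rewrite (IH (rcons s1 (v, p))) ?cat_rcons // andbT.
apply/mapP => -[[v' q] /splitPr in_s2 /= E]; subst v'.
case: in_s2 Es => t1 t2 Es.
apply: (@no_repetition (size t1).+1 v p q t1 (t2 ++ s1)) => //.
have -> : (v, p) :: t1 ++ (v, q) :: t2 ++ s1 = rot (size s1) s.
  by rewrite -Es rot_size_cat /= -!catA.
exact: shortest_rot.
Qed.

Lemma odd_knot_cycle_uniq s :
  odd_knot_cycle s ->
  exists2 s', odd_knot_cycle s' & uniq [seq m.1 | m <- s'].
Proof.
have [n] := ubnP (size s); elim: n s => // n IH s le_n os.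
case: (boolP [exists m : 'I_(size s), exists t : m.-tuple (T * T), odd_knot_cycle t]).
  case/existsP => m /existsP[t ot]; apply: (IH t) => //.
  by rewrite size_tuple; apply: leq_trans (ltn_ord m) _.
move/existsPn => short; exists s => //; apply: shortest_uniq; split=> // s' os'.
rewrite leqNgt; apply/negP => lt_s.
by move: (short (Ordinal lt_s)) => /existsPn/(_ (in_tuple s')); rewrite os'.
Qed.

(** * Transitive orientations and odd knot cycles *)

Lemma transitive_orientation_no_odd_knot_cycle s :
  comparability_graph H -> ~~ odd_knot_cycle s.
Proof.
case=> A [AE Aasym Atr]; apply/negP => /andP[].
(* Opposite directions at [x] and [y] would compose through [e] to an arc between the non-adjacent
   [x] and [y]. *)
have same_dir e f g : conn e f g -> A e f = A e g.
  move=> fg; apply: (conn_rect (P := fun g => A e f = A e g)) fg => // x y fx -> ey xy.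
  have ex := connHr fx.
  move: ex ey xy; rewrite !AE negb_or => /orP[] ex /orP[] ey /andP[nxy nyx];
    have := Aasym e x; have := Aasym e y; rewrite ex ey ?andbT /=.
  - by [].
  - by move: nyx; rewrite (Atr _ _ _ ey ex).
  - by move: nxy; rewrite (Atr _ _ _ ex ey).
  - by move=> /negbTE -> /negbTE ->.
have flip m n : knot m n -> A n.1 n.2 = ~~ A m.1 m.2.
  case/andP => c1 c2; rewrite (same_dir _ _ _ c1) -(same_dir _ _ _ c2).
  have := connHr c1; rewrite AE; have := Aasym m.1 n.1.
  by case: (A m.1 n.1); case: (A n.1 m.1).
have along m t : path (knot) m t ->
    A (last m t).1 (last m t).2 = odd (size t) (+) A m.1 m.2.
  elim: t m => //= n t IH m /andP[/flip E /IH ->].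
  by rewrite E addbN addNb.
case: s => // m s os; rewrite /cycle => /along.
by rewrite last_rcons size_rcons os; case: (A _ _).
Qed.

End Knotting.

(** * Forcing and the ordering of a bigraph *)

Section Bigraph.

Variables (V : finType) (adj : rel V) (X Y : {set V}).
Hypothesis hG : bipartite_graph adj X Y.

Local Notation same := (same_part X Y).

Lemma adj_sym : symmetric adj.
Proof. by case: hG. Qed.

Lemma in_Y u : (u \in Y) = (u \notin X).
Proof.
case: hG => _ cover disj _; apply/idP/idP => [uY|].
  by apply: contraTN uY => uX; rewrite (disjointFr disj uX).
by have := in_setT u; rewrite -cover inE => /orP[->|].
Qed.

Lemma sameE u v : same u v = ((u \in X) == (v \in X)).
Proof. by rewrite /same_part !in_Y; case: (u \in X); case: (v \in X). Qed.

Lemma adj_part u v : adj u v -> (v \in X) = (u \notin X).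
Proof.
case: hG => _ _ _ bip /bip; rewrite !in_Y.
by case: (u \in X); case: (v \in X).
Qed.

Lemma same_refl u : same u u.
Proof. by rewrite sameE. Qed.

Lemma same_sym u v : same u v = same v u.
Proof. by rewrite !sameE eq_sym. Qed.

Lemma same_trans u v w : same u v -> same v w -> same u w.
Proof. by rewrite !sameE => /eqP -> /eqP ->. Qed.

Lemma adj_not_same u v : adj u v -> ~~ same u v.
Proof. by move/adj_part; rewrite sameE => ->; case: (u \in X). Qed.

Lemma adj_same u v u' v' : adj u u' -> adj v v' -> same u v = same u' v'.
Proof.
by move=> /adj_part uu' /adj_part vv'; rewrite !sameE uu' vv'; case: (u \in X); case: (v \in X).
Qed.

(** One step of a pair of congruent walks. Orderings as in (i) must order [n] in the same way as
    [m]. *)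
Definition forces : rel (V * V) := fun m n =>
  [&& same m.1 m.2, adj m.1 n.1, adj m.2 n.2, ~~ adj m.1 n.2 & ~~ adj m.2 n.1].

Lemma forcesP a b a' b' :
  reflect [/\ same a b, adj a a', adj b b', ~~ adj a b' & ~~ adj b a']
          (forces (a, b) (a', b')).
Proof. exact: and5P. Qed.

Lemma forces_sym : symmetric forces.
Proof.
suff imp m n : forces m n -> forces n m by move=> m n; apply/idP/idP; apply: imp.
case: m n => [a b] [a' b'] /forcesP[s aa' bb' ab' ba'].
apply/forcesP; split; rewrite ?(adj_sym _ a) ?(adj_sym _ b) //.
by rewrite -(adj_same aa' bb').
Qed.

Lemma forces_swap a b a' b' : forces (a, b) (a', b') -> forces (b, a) (b', a').
Proof.
by case/forcesP => s aa' bb' ab' ba'; apply/forcesP; split; rewrite // same_sym.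
Qed.

Lemma connect_forces_sym m n : connect forces m n = connect forces n m.
Proof. exact: (sym_connect_sym forces_sym). Qed.

Lemma connect_forces_ind (P : V -> V -> Prop) a b :
  P a b ->
  (forall x y x' y', P x y -> forces (x, y) (x', y') -> P x' y') ->
  forall u v, connect forces (a, b) (u, v) -> P u v.
Proof.
move=> Pab step u v /connectP[s].
elim/last_ind: s u v => [|s [x y] IH] u v /=; first by move=> _ [-> ->].
rewrite rcons_path last_rcons => /andP[sp fs] [-> ->].
case E: (last (a, b) s) fs => [x' y'] fs.
by apply: step fs; apply: IH.
Qed.

Lemma connect_forces_swap a b u v :
  connect forces (a, b) (u, v) -> connect forces (b, a) (v, u).
Proof.
apply: (connect_forces_ind (P := fun u v => connect forces (b, a) (v, u))).
  exact: connect0.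
move=> x y x' y' c /forces_swap f; exact: connect_trans c (connect1 f).
Qed.

(** The absence of invertible pairs, by [invertible_pairP]. *)
Definition no_reversal : Prop :=
  forall u v, u != v -> same u v -> ~~ connect forces (u, v) (v, u).

(** * Linear orders in the absence of reversals *)

Section Ordering.

Hypothesis noR : no_reversal.

Let rank (u : V) : nat := enum_rank u.

Let rank_inj : injective rank.
Proof. by move=> u v /ord_inj /enum_rank_inj. Qed.

(** Encodes the lexicographic order; division by [#|V|] recovers the first component. *)
Definition weight (m : V * V) : nat := rank m.1 * #|V| + rank m.2.

Lemma weight_div m : weight m %/ #|V| = rank m.1.
Proof.
have lt2 := ltn_ord (enum_rank m.2).
by rewrite /weight divnMDl ?(leq_ltn_trans _ lt2) // divn_small ?addn0.
Qed.

Lemma weight_inj : injective weight.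
Proof.
move=> m n E; have E1 : rank m.1 = rank n.1 by rewrite -!weight_div E.
have E2 : rank m.2 = rank n.2 by move: E; rewrite /weight E1 => /addnI.
by case: m n E1 E2 {E} => [a b] [c d] /= /rank_inj -> /rank_inj ->.
Qed.

Definition leader (m : V * V) : V * V :=
  [arg min_(n < m | connect forces m n) weight n].

Definition level (m : V * V) : nat := weight (leader m).

Lemma leader_connect m : connect forces m (leader m).
Proof. by rewrite /leader; case: arg_minnP. Qed.

Lemma level_le m n : connect forces m n -> level m <= weight n.
Proof.
by rewrite /level /leader; case: arg_minnP => // k _ min /min.
Qed.

Lemma level_connect m n : connect forces m n -> level m = level n.
Proof.
move=> mn; apply/eqP; rewrite eqn_leq !level_le //.
  by apply: connect_trans (leader_connect m); rewrite connect_forces_sym.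
exact: connect_trans mn (leader_connect n).
Qed.

(** Equal levels mean a common leader, which would connect the pair to its reversal. *)
Lemma level_neq u v : u != v -> same u v -> level (u, v) != level (v, u).
Proof.
move=> uv s; apply: contra (noR uv s) => /eqP/weight_inj E.
apply: connect_trans (leader_connect _) _.
by rewrite E connect_forces_sym leader_connect.
Qed.

Definition nbr_sub u v : bool := [forall z, adj u z ==> adj v z].

Lemma nbr_subP u v : reflect (forall z, adj u z -> adj v z) (nbr_sub u v).
Proof. exact: 'forall_implyP. Qed.

Lemma nbr_subPn u v : reflect (exists2 z, adj u z & ~~ adj v z) (~~ nbr_sub u v).
Proof.
rewrite negb_forall; apply: (iffP existsP) => [[z]|[z uz vz]].
  by rewrite negb_imply => /andP[]; exists z.
by exists z; rewrite uz.
Qed.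

(* Pairs with nested neighbourhoods are not forced by any other pair; ordering
   them by inclusion keeps them out of directed triangles. The remaining pairs
   are oriented like the lexicographically least pair of their class. *)
Definition before (u v : V) : bool :=
  same u v &&
  (if nbr_sub u v then ~~ nbr_sub v u || (rank u < rank v)
   else ~~ nbr_sub v u && (level (u, v) < level (v, u))).

Lemma before_same u v : before u v -> same u v.
Proof. by case/andP. Qed.

Lemma before_asym u v : before u v -> before v u -> False.
Proof.
rewrite /before same_sym => /andP[-> /=].
by case: (nbr_sub u v); case: (nbr_sub v u) => //= /ltnW; rewrite leqNgt => /negbTE ->.
Qed.

Lemma before_total u v : same u v -> u != v -> before u v || before v u.
Proof.
move=> s uv; rewrite /before (same_sym v) s /=.
case: (nbr_sub u v); case: (nbr_sub v u) => //=; rewrite -neq_ltn.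
  by apply: contra uv => /eqP/rank_inj ->.
by rewrite level_neq // same_sym.
Qed.

Lemma forces_nbr a b a' b' : forces (a, b) (a', b') -> ~~ nbr_sub a b /\ ~~ nbr_sub b a.
Proof.
by case/forcesP => _ aa' bb' ab' ba'; split; apply/nbr_subPn; [exists a'|exists b'].
Qed.

Lemma before_forces a b a' b' : forces (a, b) (a', b') -> before a b = before a' b'.
Proof.
move=> f; have [/negbTE n1 /negbTE n2] := forces_nbr f.
have f' := f; rewrite forces_sym in f'; have [/negbTE n3 /negbTE n4] := forces_nbr f'.
rewrite /before n1 n2 n3 n4 /= (level_connect (connect1 f)).
rewrite (level_connect (connect1 (forces_swap f))).
by case/forcesP: f => -> _ _ _ _; case/forcesP: f' => ->.
Qed.

(** * Directed triangles *)

Definition triangle a b c := [&& before a b, before b c & before c a].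

Lemma triangle_rot a b c : triangle a b c -> triangle b c a.
Proof. by case/and3P => ab bc ca; apply/and3P. Qed.

(** If [c] were adjacent to only one of [a'] and [b'], a second forcing step would carry the arc
    [ab] to [cb] or [ac], against the triangle. *)
Lemma triangle_adj a b c a' b' :
  triangle a b c -> forces (a, b) (a', b') -> adj c a' = adj c b'.
Proof.
case/and3P => ab bc ca f; have := f; case/forcesP => sab aa' bb' ab' ba'.
have sca := before_same ca; have sbc := before_same bc.
apply/idP/idP; apply: contraTT => nc; apply/negP => c_.
- have f2 : forces (a', b') (c, b).
    apply/forcesP; split; rewrite // 1?adj_sym // -(adj_same aa' bb') //.
  by apply: (@before_asym b c) => //; rewrite -(before_forces f2) -(before_forces f).
- have f2 : forces (a', b') (a, c).
    apply/forcesP; split; rewrite // 1?adj_sym // -(adj_same aa' bb') //.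
  by apply: (@before_asym c a) => //; rewrite -(before_forces f2) -(before_forces f).
Qed.

Lemma forces_exists a b :
  same a b -> ~~ nbr_sub a b -> ~~ nbr_sub b a -> exists a' b', forces (a, b) (a', b').
Proof.
move=> s /nbr_subPn[a' aa' ba'] /nbr_subPn[b' bb' ab'].
by exists a', b'; apply/forcesP.
Qed.

Lemma nbr_sub_trans u v w : nbr_sub u v -> nbr_sub v w -> nbr_sub u w.
Proof. by move=> /nbr_subP uv /nbr_subP vw; apply/nbr_subP => z /uv /vw. Qed.

Lemma before_sub u v : before u v -> nbr_sub v u -> nbr_sub u v.
Proof. by case/andP => _; case: (nbr_sub u v) => // /andP[/negbTE ->]. Qed.

Lemma triangle_not_sub a b c : triangle a b c -> ~~ nbr_sub a b.
Proof.
move=> t; apply/negP => sab; have /and3P[ab bc ca] := t.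
have sbc := before_same bc; have sca := before_same ca.
(* In this case all three neighbourhoods coincide, and the ranks would increase around the
   triangle. *)
case Ebc : (nbr_sub b c).
  have sac := nbr_sub_trans sab Ebc; have scaN := before_sub ca sac.
  have sba := nbr_sub_trans Ebc scaN; have scb := nbr_sub_trans scaN sab.
  move: ab bc ca; rewrite /before sab Ebc scaN sba scb sac /=.
  move=> /andP[_ l1] /andP[_ l2] /andP[_ l3].
  by move: (ltn_trans l1 (ltn_trans l2 l3)); rewrite ltnn.
have Ecb : ~~ nbr_sub c b by apply/negP => /(before_sub bc); rewrite Ebc.
case Eca : (nbr_sub c a).
  by move: Ecb; rewrite (nbr_sub_trans Eca sab).
have Eac : ~~ nbr_sub a c by apply/negP => /(before_sub ca); rewrite Eca.
(* Now [b] and [c] are incomparable, and [triangle_adj] makes [c1] a neighbour of [a] outside the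
   neighbourhood of [b]. *)
have /nbr_subPn[a1 aa1 ca1] := Eac.
have /nbr_subPn[c1 cc1 bc1] := Ecb.
have ba1 := nbr_subP _ _ sab _ aa1.
have f : forces (b, c) (a1, c1) by apply/forcesP.
have := triangle_adj (triangle_rot t) f; rewrite aa1 => /esym ac1.
by move: bc1; rewrite (nbr_subP _ _ sab _ ac1).
Qed.

Lemma triangle_incomparable a b c :
  triangle a b c -> ~~ nbr_sub a b /\ ~~ nbr_sub b a.
Proof.
move=> t; have n := triangle_not_sub t; split=> //; apply/negP => /before_sub.
by case/and3P: t => ab _ _ /(_ ab); apply/negP.
Qed.

(* The vertex c' of the other part takes the place of c whenever the arc ab is
   moved along an edge of the forcing relation. *)
Definition good_triangle a b c c' :=
  [&& triangle a b c, adj a c' != adj c c' & adj b c' != adj c c'].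

(** Force [bc] to a pair [(b1, c1)]: [a] is adjacent to both or to neither, and [b1] or [c1],
    respectively, separates [c] from [a] and [b]. *)
Lemma good_triangle_exists a b c : triangle a b c -> exists c', good_triangle a b c c'.
Proof.
move=> t; have t2 := triangle_rot t; have [n1 n2] := triangle_incomparable t2.
have /and3P[_ /before_same s _] := t.
have [b1 [c1 f]] := forces_exists s n1 n2.
have E := triangle_adj t2 f; case/forcesP: f => _ bb1 cc1 bc1 cb1.
rewrite /good_triangle t; case: (boolP (adj a b1)) E => ab1 /esym E.
  by exists b1; rewrite ab1 bb1 (negbTE cb1).
by exists c1; rewrite E cc1 (negbTE bc1).
Qed.

Lemma good_triangle_move a b c c' a' b' :
  good_triangle a b c c' -> forces (a, b) (a', b') -> good_triangle a' b' c' c.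
Proof.
move=> /and3P[t]; have t3 := triangle_rot (triangle_rot t).
have [n1 n2] := triangle_incomparable t3.
have /and3P[ab bc ca] := t.
have sca := before_same ca; have sbc := before_same bc.
case: (boolP (adj c c')) => cc'; rewrite ?eqb_id ?eqbF_neg ?negbK => ac' bc' f;
  have E := triangle_adj t f; have := f; case/forcesP => sab aa' bb' ab' ba'.
(* The auxiliary neighbour [a1] of [a] serves to show that [c] is adjacent to neither [a'] nor [b'].
   Then [bc] and [ca] force [b'c'] and [c'a']. *)
- have /nbr_subPn[a1 aa1 ca1] := n2.
  have f1 : forces (c, a) (c', a1) by apply/forcesP.
  have ba1 : ~~ adj b a1 by rewrite -(triangle_adj t3 f1) .
  have f2 : forces (a, b) (a1, b') by apply/forcesP.
  have cb' : ~~ adj c b' by rewrite -(triangle_adj t f2).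
  have ca' : ~~ adj c a' by rewrite E.
  have f3 : forces (b, c) (b', c') by apply/forcesP.
  have f4 : forces (c, a) (c', a') by apply/forcesP.
  rewrite /good_triangle /triangle -(before_forces f) -(before_forces f3) -(before_forces f4).
  by rewrite ab bc ca !(adj_sym _ c) cc' (negbTE ca') (negbTE cb').
(* Here [c] is adjacent to both [a'] and [b'], and the two arcs exchange positions: [ca] forces
   [b'c'] and [bc] forces [c'a']. *)
- have /nbr_subPn[c1 cc1 ac1] := n1.
  have f1 : forces (c, a) (c1, c') by apply/forcesP.
  have bc1 : adj b c1 by rewrite (triangle_adj t3 f1).
  have f2 : forces (a, b) (a', c1) by apply/forcesP.
  have ca' : adj c a' by rewrite (triangle_adj t f2).
  have cb' : adj c b' by rewrite -E.
  have f3 : forces (c, a) (b', c') by apply/forcesP.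
  have f4 : forces (b, c) (c', a') by apply/forcesP.
  rewrite /good_triangle /triangle -(before_forces f) -(before_forces f3) -(before_forces f4).
  by rewrite ab bc ca !(adj_sym _ c) (negbTE cc') ca' cb'.
Qed.

(** Each move exchanges [c] and [c'], whence the two alternatives. *)
Lemma good_triangle_connect a b c c' u v :
  good_triangle a b c c' -> connect forces (a, b) (u, v) ->
  good_triangle u v c c' \/ good_triangle u v c' c.
Proof.
move=> g; apply: (connect_forces_ind
  (P := fun u v => good_triangle u v c c' \/ good_triangle u v c' c)); first by left.
by move=> x y x' y' [] h /(good_triangle_move h); [right|left].
Qed.

Lemma no_triangle a b c : ~~ triangle a b c.
Proof.
apply/negP => t0.
pose is_t (m : V * V * V) := triangle m.1.1 m.1.2 m.2.
have [[[a1 b1] c1] /= t1 min] :=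
  @arg_minnP _ (a, b, c) is_t (fun m => level m.1) t0.
have min3 x y z : triangle x y z -> level (a1, b1) <= level (x, y).
  by move=> t; apply: (min (x, y, z)).
have [c' g] := good_triangle_exists t1.
case El : (leader (a1, b1)) => [u v].
have cuv : connect forces (a1, b1) (u, v) by rewrite -El leader_connect.
have luv : level (a1, b1) = weight (u, v) by rewrite /level El.
have [w tw] : exists w, triangle u v w.
  by case: (good_triangle_connect g cuv) => /and3P[t _ _]; [exists c1|exists c'].
have twu := triangle_rot (triangle_rot tw).
have [v' g'] := good_triangle_exists twu.
case El' : (leader (w, u)) => [x y].
have cxy : connect forces (w, u) (x, y) by rewrite -El' leader_connect.
have lwu : level (w, u) < level (u, w).
  have [/negbTE n1 /negbTE n2] := triangle_incomparable twu.
  by case/and3P: twu => /andP[_]; rewrite n1 n2.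
have lxy : level (w, u) = weight (x, y) by rewrite /level El'.
have le1 : weight (u, v) <= weight (x, y) by rewrite -luv -lxy; apply: min3 twu.
have le2 : weight (x, y) <= weight (u, w).
  by rewrite -lxy; apply: leq_trans (ltnW lwu) (level_le (connect0 _ _)).
(* The weight of [(x, y)] lies between those of two pairs starting with [u]. *)
have x_u : x = u.
  apply: rank_inj; apply/eqP; rewrite eqn_leq.
  have := leq_div2r #|V| le1; have := leq_div2r #|V| le2.
  by rewrite !weight_div /= => -> ->.
subst x; case/and3P: tw => uv _ _.
(* If the third vertex is still [v], the arc [uv] is reversed. Otherwise [v'] would lie in the
   common part of [v] and [w], although it is adjacent to one of them. *)
case: (good_triangle_connect g' cxy) => /and3P[/and3P[_ _]].
  by move=> vu; case: (before_asym uv vu).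
move/before_same; have := before_same uv => suv sv'u _ _.
have svv' : same v v' by rewrite same_sym; apply: same_trans suv; apply: sv'u.
case/and3P: g' => /and3P[/before_same swu _ _] .
case: (boolP (adj v v')) => [/adj_not_same|_]; first by rewrite svv'.
rewrite eqbF_neg negbK => /adj_not_same/negP[].
by apply: same_trans swu _; apply: same_trans suv svv'.
Qed.

Lemma before_trans u v w : before u v -> before v w -> before u w.
Proof.
move=> uv vw; have s := same_trans (before_same uv) (before_same vw).
have [E|uw] := eqVneq u w; first by subst; case: (before_asym uv vw).
case/orP: (before_total s uw) => // wu.
by case/negP: (no_triangle u v w); apply/and3P.
Qed.

Lemma no_reversal_cocomparability : cocomparability_bigraph adj X Y.
Proof.
have lin (A : {set V}) : {in A &, forall u v, same u v} -> strict_linear_order_on A before.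
  move=> sA; split.
  - by move=> u _; apply/negP => uu; apply: (before_asym uu uu).
  - by move=> v u w _ _ _; apply: before_trans.
  - by move=> u v uA vA uv; apply: before_total => //; apply: sA.
exists before, before; split.
- by apply: lin => u v uX vX; rewrite sameE uX vX.
- by apply: lin => u v; rewrite !in_Y sameE => /negbTE -> /negbTE ->.
move=> u v w z uX vX _ _ uv wz uz vw; apply: contraT; rewrite negb_or => /andP[uw vz].
have f : forces (u, v) (z, w) by apply/forcesP; rewrite sameE uX vX.
by rewrite (before_forces f) in uv; case: (before_asym uv wz).
Qed.

End Ordering.

(** * Congruent walks as forcing paths *)

Lemma independent_pairs a a' b b' :
  same a b -> adj a a' -> adj b b' ->
  independent adj X Y [set a; a'] [set b; b'] = ~~ adj a b' && ~~ adj b a'.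
Proof.
move=> sab aa' bb'.
apply/and3P/andP => [[_ /forall_inP i1 /forall_inP i2]|[n1 n2]].
  have cross x y : x \in [set a; a'] -> y \in [set b; b'] -> ~~ adj x y.
    move=> xa yb; apply/negP => xy; have := adj_part xy.
    case xX : (x \in X) => /= yX.
      have xI : x \in [set a; a'] :&: X by rewrite inE xa.
      have yI : y \in [set b; b'] :&: Y by rewrite inE yb in_Y yX.
      by have /forall_inP/(_ y yI) := i1 x xI; rewrite xy.
    have xI : x \in [set a; a'] :&: Y by rewrite inE xa in_Y xX.
    have yI : y \in [set b; b'] :&: X by rewrite inE yb yX.
    by have /forall_inP/(_ x xI) := i2 y yI; rewrite adj_sym xy.
  by rewrite [adj b a']adj_sym !cross // !inE eqxx ?orbT.
have cross x y : x \in [set a; a'] -> y \in [set b; b'] -> ~~ adj x y.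
  rewrite !inE => /orP[]/eqP-> /orP[]/eqP-> //; rewrite 1?[adj a' b]adj_sym //.
    by apply: contraL sab => /adj_not_same.
  by apply: contraL sab => /adj_not_same; rewrite (adj_same aa' bb').
split.
(* A common end would be adjacent to the other end of the first edge, against [cross]. *)
- rewrite disjoint_subset; apply/subsetP => x xa; rewrite inE; apply/negP => xb.
  have := cross a x; have := cross a' x; rewrite xb !inE !eqxx orbT.
  move=> /(_ isT isT) ca' /(_ isT isT) ca.
  by move: xa ca ca'; rewrite !inE => /orP[] /eqP ->; rewrite ?aa' // adj_sym aa'.
- apply/forall_inP => x; rewrite inE => /andP[xa _].
  by apply/forall_inP => y; rewrite inE => /andP[yb _]; apply: cross.
- apply/forall_inP => x; rewrite inE => /andP[xb _].
  by apply/forall_inP => y; rewrite inE => /andP[ya _]; rewrite adj_sym; apply: cross.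
Qed.

(** Adjacent steps keep both walks in a common part, so each independence reduces to the
    non-adjacencies of [forces]. *)
Lemma forces_zip u v a b :
  same u v -> size a = size b ->
  path forces (u, v) (zip a b) =
  [&& path adj u a, path adj v b
    & all2 (independent adj X Y) (walk_edges (u :: a)) (walk_edges (v :: b))].
Proof.
elim: a u v b => [|x a IH] u v [|y b] //= suv [sz].
case ux : (adj u x); case vy : (adj v y); rewrite /forces /= ux vy ?andbF //=.
have sxy : same x y by rewrite -(adj_same ux vy).
rewrite suv /= IH // independent_pairs //.
by case: (~~ adj u y && _); rewrite ?andbF.
Qed.

Lemma invertible_pairP u v :
  invertible_pair adj X Y u v <->
  [/\ u != v, same u v & connect forces (u, v) (v, u)].
Proof.
split=> [[uv [[|u' a] [[|v' b] []]]]|[uv suv /connectP[s fs Es]]].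
- by [].
- by [].
- by [].
- move=> /and3P[/= wa /eqP Eu /eqP la] /and3P[/= wb /eqP Ev /eqP lb] /and3P[].
  subst u' v' => /eqP[sz] suv ind; split=> //.
  apply/connectP; exists (zip a b).
    rewrite forces_zip //; apply/and3P; split=> //.
  have -> : last (u, v) (zip a b) = (last u a, last v b).
    elim: a u v b sz {wa wb la lb ind suv uv} => [|x a IH] u v [|y b] //= [sz].
    exact: IH.
  by rewrite la lb.
split=> //; exists (u :: unzip1 s), (v :: unzip2 s).
have sz : size (unzip1 s) = size (unzip2 s) by rewrite !size_map.
move: fs; rewrite -{1}(zip_unzip s) forces_zip // => /and3P[pu pv ind].
have l1 : last u (unzip1 s) = v by rewrite (last_map fst s (u, v)) -Es.
have l2 : last v (unzip2 s) = u by rewrite (last_map snd s (u, v)) -Es.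
by split; apply/and3P; split; rewrite //= ?l1 ?l2 ?sz // /is_walk.
Qed.

(** * Independence of edges and asteroids *)

(* Edges are handled as pairs with first component in X. *)
Definition is_edge (e : V * V) : bool := (e.1 \in X) && adj e.1 e.2.

Definition indep : rel (V * V) := fun e f =>
  [&& is_edge e, is_edge f, ~~ adj e.1 f.2 & ~~ adj f.1 e.2].

Definition orient (a b : V) : V * V := if a \in X then (a, b) else (b, a).

Definition ends (e : V * V) : {set V} := [set e.1; e.2].

Lemma indep_sym : symmetric indep.
Proof.
suff imp e f : indep e f -> indep f e by move=> m n; apply/idP/idP; apply: imp.
by case/and4P => a b c d; apply/and4P.
Qed.

Lemma indep_irr : irreflexive indep.
Proof.
by move=> e; apply/negP => /and4P[/andP[_ ->]].
Qed.

Lemma is_edge_orient a b : adj a b -> is_edge (orient a b).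
Proof.
move=> ab; rewrite /is_edge /orient; case aX : (a \in X) => /=; first by rewrite aX.
by rewrite adj_sym ab (adj_part ab) aX.
Qed.

Lemma orient_sym a b : adj a b -> orient a b = orient b a.
Proof. by move/adj_part; rewrite /orient => ->; case: (a \in X). Qed.

Lemma indep_orient a b a' b' :
  same a b -> adj a a' -> adj b b' ->
  indep (orient a a') (orient b b') = ~~ adj a b' && ~~ adj b a'.
Proof.
move=> sab aa' bb'; rewrite /indep !is_edge_orient //=.
move: sab; rewrite sameE /orient => /eqP <-.
by case: (a \in X) => //=; rewrite [adj a' b]adj_sym [adj b' a]adj_sym andbC.
Qed.

(** * From forcing paths to odd knot cycles *)

Lemma forces_indep a b a' b' :
  forces (a, b) (a', b') -> indep (orient a a') (orient b b').
Proof. by case/forcesP => s aa' bb' ab' ba'; rewrite indep_orient // ab'. Qed.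

Lemma conn_common_vertex e a b c :
  adj a b -> adj a c -> indep e (orient a b) -> indep e (orient a c) ->
  conn indep e (orient a b) (orient a c).
Proof.
by move=> ab ac eb ec; apply: conn1 => //; rewrite indep_orient ?same_refl // ac.
Qed.

(** Consecutive edges of one walk share a vertex, hence lie in one class at any edge of the other
    walk that is independent of both. *)
Lemma forces_knot m n r :
  forces m n -> forces n r ->
  knot indep (orient m.1 n.1, orient m.2 n.2) (orient n.2 r.2, orient n.1 r.1).
Proof.
case: m n r => [a b] [a' b'] [a'' b''] f f' /=.
have := f; case/forcesP => sab aa' bb' ab' ba'.
have := f'; case/forcesP => sab' aa'' bb'' ab'' ba''.
have i1 := forces_indep f; have i2 := forces_indep f'.
have i3 : indep (orient a a') (orient b' b'').
  by rewrite orient_sym // indep_orient // ?[adj a' a]adj_sym // ab'' adj_sym.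
have i4 : indep (orient a' a'') (orient b b').
  by rewrite [orient b _]orient_sym // indep_orient // 1?[adj b' b]adj_sym // ba'' andbT adj_sym.
have a'a : adj a' a by rewrite adj_sym.
have b'b : adj b' b by rewrite adj_sym.
rewrite /knot /= (orient_sym aa') (orient_sym bb') in i1 i3 i4 *.
rewrite !conn_common_vertex //; first by rewrite indep_sym.
by rewrite indep_sym.
Qed.

Lemma reversal_odd_knot_cycle u v :
  u != v -> same u v -> connect forces (u, v) (v, u) ->
  exists s, odd_knot_cycle indep s.
Proof.
pose N (m n : V * V) := (orient m.1 n.1, orient m.2 n.2).
have walk s m n : forces m n -> path forces n s -> exists t l,
    [/\ path (knot indep) (N m n) t, ~~ odd (size t), forces l (last n s)
      & last (N m n) t = N l (last n s)].
  elim: s m n => [|r s IH] m n /=; first by exists [::], m.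
  move=> fmn /andP[fnr ps]; have [t [l [pt ot fl El]]] := IH _ _ fnr ps.
  (* Each forcing step takes two knot steps: [forces_knot] exchanges the walks, and a step between
     the same two edges exchanges them back. *)
  exists ((orient n.2 r.2, orient n.1 r.1) :: N n r :: t), l; split=> //=.
    rewrite forces_knot //= pt andbT /knot /= !conn_refl //.
      exact: forces_indep.
    by rewrite indep_sym; apply: forces_indep.
  by rewrite negbK.
move=> uv suv /connectP[[|n s] /=]; first by move=> _ [E]; rewrite E eqxx in uv.
move=> /andP[f0 ps] Es; have [t [l [pt ot fl El]]] := walk _ _ _ f0 ps.
(* As the walks end at [(v, u)], the exchange in [forces_knot] leads straight to the first node;
   this single step closes a cycle of odd size. *)
exists (N (u, v) n :: t); rewrite /odd_knot_cycle /= ot rcons_path pt El /=.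
rewrite -Es in fl *; case: n f0 {ps Es pt El} => n1 n2 f0.
exact: (forces_knot fl (forces_swap f0)).
Qed.

(** * Edges as sets and as pairs *)

Lemma independentE e f :
  is_edge e -> is_edge f -> independent adj X Y (ends e) (ends f) = indep e f.
Proof.
move=> ee ef; rewrite /indep ee ef /=; case/andP: ee => eX ea; case/andP: ef => fX fa.
by rewrite /ends independent_pairs // sameE eX fX.
Qed.

Lemma edgesP (f : {set V}) :
  reflect (exists2 e, is_edge e & f = ends e) (f \in edges adj X Y).
Proof.
apply: (iffP imset2P) => [[x y xX]|[[x y] /andP[/= xX xy] ->]].
  by rewrite inE => /andP[_ xy] ->; exists (x, y); rewrite // /is_edge xX.
by exists x y; rewrite // inE in_Y (adj_part xy) xX xy.
Qed.

Lemma ends_inj e f : is_edge e -> is_edge f -> ends e = ends f -> e = f.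
Proof.
case: e f => [x y] [x' y'] /andP[/= xX xy] /andP[/= x'X xy'] /setP E.
have := E x; have := E y; rewrite !inE !eqxx orbT /=.
have yX := adj_part xy; have y'X := adj_part xy'.
have -> : (y == x') = false by apply: contraTF x'X => /eqP <-; rewrite yX xX.
have -> : (x == y') = false by apply: contraTF xX => /eqP ->; rewrite y'X x'X.
by rewrite /= orbF => /esym/eqP -> /esym/eqP ->.
Qed.

Lemma comparability_pairs :
  comparability_graph (edge_graph adj X Y) <-> comparability_graph indep.
Proof.
have pair_ex (f : {f : {set V} | f \in edges adj X Y}) : exists e, is_edge e && (val f == ends e).
  by case: f => f /= /edgesP[e ee ->]; exists e; rewrite ee eqxx.
pose pair f := xchoose (pair_ex f).
have pairP f : is_edge (pair f) /\ val f = ends (pair f).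
  by have /andP[? /eqP] := xchooseP (pair_ex f).
have graphE f g : edge_graph adj X Y f g = indep (pair f) (pair g).
  have [ef Ef] := pairP f; have [eg Eg] := pairP g.
  by rewrite /edge_graph Ef Eg independentE.
have pairK e : is_edge e -> exists f, pair f = e.
  move=> ee; have ef : ends e \in edges adj X Y by apply/edgesP; exists e.
  pose f := exist (fun f => f \in edges adj X Y) (ends e) ef.
  exists f; have [e' E] := pairP f.
  by apply: ends_inj => //; rewrite -E.
split=> [[A [AE Aasym Atr]]|[A [AE Aasym Atr]]].
  pose B e e' := [exists f, exists g, [&& pair f == e, pair g == e' & A f g]].
  have pair_inj : injective pair.
    by move=> f g E; apply: val_inj; rewrite (pairP f).2 (pairP g).2 E.
  have BP e e' : reflect (exists f g, [/\ pair f = e, pair g = e' & A f g]) (B e e').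
    apply: (iffP existsP) => [[f /existsP[g /and3P[/eqP ef /eqP eg a]]]|[f [g [ef eg a]]]].
      by exists f, g.
    by exists f; apply/existsP; exists g; rewrite ef eg !eqxx.
  exists B; split.
  - move=> e e'; apply/idP/orP.
      move=> i; have /and4P[/pairK[f Ef] /pairK[g Eg] _ _] := i.
      move: i; rewrite -Ef -Eg -graphE AE => /orP[a|a]; [left|right]; apply/BP.
        by exists f, g.
      by exists g, f.
    case=> /BP[f [g [<- <- a]]]; last rewrite indep_sym.
      by rewrite -graphE AE a.
    by rewrite -graphE AE a.
  - move=> e e'; apply/negP => /andP[/BP[f [g [<- <- a]]]].
    case/BP=> f' [g' [/pair_inj -> /pair_inj -> a']].
    by have := Aasym f g; rewrite a a'.
  - move=> e' e e'' /BP[f [g [<- <- a]]] /BP[f' [g' [/pair_inj -> <- a']]].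
    by apply/BP; exists f, g'; split=> //; apply: Atr a a'.
exists (fun f g => A (pair f) (pair g)); split.
- by move=> f g; rewrite graphE.
- by move=> f g.
- by move=> f g h; apply: Atr.
Qed.

(** * Orderings, orientations and asteroids *)

Lemma cocomparability_comparability :
  cocomparability_bigraph adj X Y -> comparability_graph (edge_graph adj X Y).
Proof.
case=> ltX [ltY [[irrX trX totX] [irrY trY totY] cross]]; apply/comparability_pairs.
(* Independent edges are ordered alike in [X] and in [Y], which makes the orientation by ends in [X]
   transitive. *)
have agree e f : indep e f -> ltX e.1 f.1 -> ltY e.2 f.2.
  move=> /and4P[/andP[eX ea] /andP[fX fa] ef fe] lt1.
  have eY : e.2 \in Y by rewrite in_Y (adj_part ea) eX.
  have fY : f.2 \in Y by rewrite in_Y (adj_part fa) fX.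
  have ne : e.2 != f.2 by apply: contraNneq ef => <-.
  case/orP: (totY _ _ eY fY ne) => // lt2.
  by have := cross _ _ _ _ eX fX fY eY lt1 lt2 ea fa; rewrite (negbTE ef) (negbTE fe).
exists (fun e f => indep e f && ltX e.1 f.1); split.
- move=> e f; rewrite [indep f e]indep_sym -andb_orr.
  case: (boolP (indep e f)) => //= /and4P[/andP[eX ea] /andP[fX fa] ef _].
  by symmetry; apply: totX => //; apply: contraNneq ef => ->.
- move=> e f; apply/negP => /andP[/andP[i l1] /andP[_ l2]].
  have /and4P[/andP[eX _] /andP[fX _] _ _] := i.
  by have := irrX _ eX; rewrite (trX _ _ _ fX eX eX l1 l2).
move=> f e g /andP[ief l1] /andP[ifg l2].
have m1 := agree _ _ ief l1; have m2 := agree _ _ ifg l2.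
have /and4P[/andP[eX ea] /andP[fX fa] ef fe] := ief.
have /and4P[_ /andP[gX ga] fg gf] := ifg.
have eY : e.2 \in Y by rewrite in_Y (adj_part ea) eX.
have fY : f.2 \in Y by rewrite in_Y (adj_part fa) fX.
have gY : g.2 \in Y by rewrite in_Y (adj_part ga) gX.
rewrite (trX _ _ _ fX eX gX l1 l2) andbT; apply/and4P; split.
- by rewrite /is_edge eX.
- by rewrite /is_edge gX.
- apply/negP => eg; have := cross _ _ _ _ eX fX fY gY l1 m2 eg fa.
  by rewrite (negbTE ef) (negbTE fg).
- apply/negP => ge; have := cross _ _ _ _ fX gX eY fY l2 m1 fa ge.
  by rewrite (negbTE fe) (negbTE gf).
Qed.

Lemma cocomparability_orientation :
  cocomparability_bigraph adj X Y ->
  exists M : mixed_graph V,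
    [/\ complement_orientation adj X Y M, acyclic M & T_free adj X Y M].
Proof.
case=> ltX [ltY [[irrX trX totX] [irrY trY totY] cross]].
pose lt u v := if u \in X then ltX u v else ltY u v.
pose le u v := same u v && lt u v.
have le_irr u : ~~ le u u.
  by rewrite /le same_refl /lt; case uX : (u \in X); rewrite ?irrX ?irrY // in_Y uX.
have le_trans : transitive le.
  move=> v u w /andP[suv uv] /andP[svw vw]; rewrite /le (same_trans suv svw) /=.
  move: suv svw uv vw; rewrite !sameE /lt => /eqP Eu /eqP Ev; rewrite -Eu in Ev *.
  by case uX : (u \in X) Eu Ev => /esym vX /esym wX;
    [apply: trX | apply: trY]; rewrite // in_Y ?uX ?vX ?wX.
have le_total u v : le u v || le v u = (u != v) && same u v.
  rewrite /le [same v u]same_sym; case: (boolP (same u v)) => suv; rewrite ?andbF //= andbT.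
  have [<-|uv] /= := eqVneq u v.
    by have := le_irr u; rewrite /le same_refl => /= /negbTE ->.
  move: suv; rewrite sameE /lt => /eqP Eu; rewrite -Eu.
  by case uX : (u \in X) Eu => /esym vX; [apply: totX | apply: totY]; rewrite // in_Y ?uX ?vX.
exists (MixedGraph (fun u v => ~~ same u v && ~~ adj u v) le); split.
- split=> //= u v; apply/negP => /andP[uv vu].
  by move: (le_irr u); rewrite (le_trans _ _ _ uv vu).
- case=> -[|x c] /and3P[//= _ _ /(order_path_min le_trans)].
  by rewrite all_rcons (negbTE (le_irr x)).
case=> x [x' [y [y' [/and4P[xX x'X yY y'Y] [xy x'y'] [xy' x'y] [/= /andP[_ l1] /andP[_ l2]]]]]].
move: l1 l2; rewrite /lt xX; move: (yY); rewrite in_Y => /negbTE -> l1 l2.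
by have := cross _ _ _ _ xX x'X yY y'Y l1 l2 xy' x'y; rewrite (negbTE xy) (negbTE x'y').
Qed.

(** Arcs persist along forcing, since opposite arcs on a pair and a forced pair form the forbidden
    configuration. So an invertible pair would be oriented both ways. *)
Lemma T_free_no_invertible_pair (M : mixed_graph V) u v :
  complement_orientation adj X Y M -> T_free adj X Y M ->
  ~ invertible_pair adj X Y u v.
Proof.
move=> [_ tot asym] tf /invertible_pairP[uv suv c].
have arc_forces a b a' b' : Defs.arc M a b -> forces (a, b) (a', b') -> Defs.arc M a' b'.
  move=> ab /forcesP[sab aa' bb' ab' ba'].
  have sab' : same a' b' by rewrite -(adj_same aa' bb').
  have ne : a' != b' by apply: contraNneq ab' => <-.
  have := tot a' b'; rewrite ne sab' => /orP[//|b'a']; case: tf.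
  have aE := adj_part aa'; have bE := adj_part bb'.
  have := sab; rewrite sameE => /eqP Eab.
  case aX : (a \in X) aE Eab => /= a'X /esym bX.
    by exists a, b, b', a'; rewrite !in_Y bE a'X aX bX /=.
  exists b', a', a, b; rewrite !in_Y bE a'X aX bX /=.
  by rewrite ![adj b' _]adj_sym ![adj a' _]adj_sym.
have arc_connect a b a' b' : Defs.arc M a b -> connect forces (a, b) (a', b') -> Defs.arc M a' b'.
  move=> ab; apply: (connect_forces_ind (P := fun x y => Defs.arc M x y) ab).
  by move=> x y x' y' xy f; exact: arc_forces xy f.
have := tot u v; rewrite uv suv => /orP[a|a].
  by have := asym u v; rewrite a (arc_connect _ _ _ _ a c).
by have := asym u v; rewrite a (arc_connect _ _ _ _ a (connect_forces_swap c)).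
Qed.

(** A walk avoiding the neighbours of [e i] stays on one side of [e i] in the two orders. The side
    of [e (i + k)] flips under the shift of [i] by [k + 1], and [2k + 1] such shifts return to the
    start. *)
Lemma cocomparability_no_weak_edge_asteroid k (e : 'I_(k.*2.+1) -> {set V}) :
  cocomparability_bigraph adj X Y -> ~ weak_edge_asteroid adj X Y e.
Proof.
case=> ltX [ltY [[irrX trX totX] [irrY trY totY] cross]] [k_gt0 edge walk].
have /fin_all_exists[p pP] i : exists p, is_edge p /\ e i = ends p.
  by have /edgesP[p ep Ep] := edge i; exists p.
pose side i z := if z \in X then ltX (p i).1 z else ltY (p i).2 z.
have step i z z' : {in [:: z; z'] & e i, forall z v, ~~ adj z v} -> adj z z' ->
    z \in X -> side i z = side i z'.
  move=> nadj zz' zX; have [/andP[xX xy] Ei] := pP i.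
  have z'X := adj_part zz'; rewrite zX in z'X; rewrite /side zX z'X.
  have z'Y : z' \in Y by rewrite in_Y z'X.
  have yY : (p i).2 \in Y by rewrite in_Y (adj_part xy) xX.
  have nzy : ~~ adj z (p i).2 by apply: nadj; rewrite ?Ei !inE eqxx ?orbT.
  have nxz' : ~~ adj (p i).1 z'.
    by rewrite adj_sym; apply: nadj; rewrite ?Ei !inE eqxx ?orbT.
  have nexz : (p i).1 != z by apply: contraNneq nzy => <-.
  have neyz : (p i).2 != z' by apply: contraNneq nxz' => <-.
  apply/idP/idP => lt.
    case/orP: (totY _ _ yY z'Y neyz) => // lt'.
    by have := cross _ _ _ _ xX zX z'Y yY lt lt' xy zz'; rewrite (negbTE nxz') (negbTE nzy).
  case/orP: (totX _ _ xX zX nexz) => // lt'.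
  by have := cross _ _ _ _ zX xX yY z'Y lt' lt zz' xy; rewrite (negbTE nxz') (negbTE nzy).
have constant i w : is_walk adj w -> {in w & e i, forall z v, ~~ adj z v} ->
    {in w &, forall z z', side i z = side i z'}.
  case: w => // z0 w /andP[_ /= pw] nadj.
  suff all0 z : z \in z0 :: w -> side i z = side i z0 by move=> z z' /all0 -> /all0 ->.
  elim: w z0 pw nadj z => [|z1 w IH] z0 /=; first by move=> _ _ z; rewrite inE => /eqP ->.
  move=> /andP[z01 pw] nadj z; rewrite inE => /orP[/eqP -> //|zw].
  have sub1 : {subset z1 :: w <= z0 :: z1 :: w} by move=> x xw; rewrite inE xw orbT.
  rewrite (IH z1 pw _ z zw); last by move=> x v /sub1; apply: nadj.
  have nadj01 : {in [:: z0; z1] & e i, forall z v, ~~ adj z v}.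
    by move=> x v xz; apply: nadj; move: xz; rewrite !inE => /orP[]/eqP ->; rewrite eqxx ?orbT.
  case z0X : (z0 \in X); first by rewrite (step i z0 z1).
  apply: (step i z1 z0); rewrite // 1?adj_sym ?(adj_part z01) ?z0X //.
  by move=> x v xz; apply: nadj01; move: xz; rewrite !inE orbC.
pose d (i : 'I_(k.*2.+1)) := ltX (p i).1 (p (inZp (i + k))).1.
have in1 i : (p i).1 \in e i by rewrite (pP i).2 /ends !inE eqxx.
have X1 i : (p i).1 \in X by have [/andP[]] := pP i.
(* Both [e (i + k)] and [e (i + k + 1)] lie on the same side of [e i]. As [i + k + 1 + k] is [i]
   modulo [2k + 1], the index [i + k + 1] makes the latter comparison in reverse. *)
have flip (i : 'I_(k.*2.+1)) : d (inZp (i + k + 1)) = ~~ d i.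
  have [w [ww s1 s2 nadj]] := walk i.
  have := constant i w ww nadj _ _ (s1 _ (in1 _)) (s2 _ (in1 _)).
  rewrite /side !X1 -/(d i) => ->; rewrite /d.
  set j : 'I_(k.*2.+1) := inZp (i + k + 1).
  have -> : inZp (j + k) = i.
    apply: val_inj; rewrite /= modnDml (_ : i + k + 1 + k = i + k.*2.+1).
      by rewrite modnDr modn_small.
    by rewrite -!addnA add1n addnS addnn.
  have ne : (p i).1 != (p j).1.
    have /andP[_ ij] : is_edge (p j) by case: (pP j).
    apply/eqP => E; have := nadj (p j).2 (p i).1.
    rewrite E adj_sym ij; move/(_ _ _)/negP; apply=> //.
      by apply: s2; rewrite (pP j).2 /ends !inE eqxx orbT.
    by rewrite -E.
  have := totX _ _ (X1 i) (X1 j) ne.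
  case lij : (ltX (p i).1 (p j).1); case lji : (ltX (p j).1 (p i).1) => //= _.
  by have := irrX _ (X1 i); rewrite (trX _ _ _ (X1 j) (X1 i) (X1 i) lij lji).
have iter m : d (inZp (m * k.+1)) = odd m (+) d (inZp 0).
  elim: m => [|m IH]; first by rewrite mul0n.
  have <- : inZp ((inZp (m * k.+1) : 'I_(k.*2.+1)) + k + 1) = inZp (m.+1 * k.+1) :> 'I_(k.*2.+1).
    by apply: val_inj; rewrite /= -addnA modnDml mulSn addn1 addnC.
  by rewrite flip IH addNb.
have := iter k.*2.+1; rewrite /= odd_double.
have -> : inZp (k.*2.+1 * k.+1) = inZp 0 :> 'I_(k.*2.+1).
  by apply: val_inj; rewrite /= modnMr mod0n.
by case: (d _).
Qed.

(** * From odd knot cycles to edge-asteroids *)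

Lemma conn_walk e f g :
  conn indep e f g ->
  exists w, [/\ is_walk adj w, {subset ends f <= w}, {subset ends g <= w}
    & {in w & ends e, forall z v, ~~ adj z v}].
Proof.
pose free z := ~~ adj z e.1 && ~~ adj z e.2.
have free_ends h : indep e h -> is_edge e /\ is_edge h /\ free h.1 /\ free h.2.
  move=> /and4P[ee eh n1 n2]; do 2 split=> //.
  case/andP: (ee) (eh) => eX ea /andP[hX ha]; rewrite /free n2 [adj h.2 _]adj_sym n1 !andbT.
  split; first by apply: contraL hX => /adj_part; rewrite eX => <-.
  have := adj_part ea; have := adj_part ha; rewrite eX hX /= => hY eY.
  by apply: contraFN eY => /adj_part ->; rewrite hY.
move=> fg; have ef := connHl fg; have [ee [/andP[_ fa] [f1 f2]]] := free_ends _ ef.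
have [q [pq lq aq]] : exists q, [/\ path adj f.1 q, last f.1 q = g.1 & all free q].
  apply: (conn_rect (P := fun g =>
    exists q, [/\ path adj f.1 q, last f.1 q = g.1 & all free q])) fg.
    by exists [::].
  move=> x y fx [q [pq lq aq]] ey xy.
  have ex := connHr fx.
  have [_ [xe [x1 x2]]] := free_ends _ ex; have [_ [ye [y1 y2]]] := free_ends _ ey.
  have /andP[_ xa] := xe; have /andP[_ ya] := ye.
  (* Edges [x] and [y] that are not independent have a cross edge, so the walk goes from [x.1] to
     [y.1] through [y.2] or [x.2]. *)
  move: xy; rewrite /indep xe ye /= negb_and !negbK => /orP[xy|yx].
    exists (q ++ [:: y.2; y.1]).
    by rewrite cat_path last_cat all_cat pq lq aq /= xy [adj y.2 _]adj_sym ya y1 y2.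
  exists (q ++ [:: x.2; y.1]).
  by rewrite cat_path last_cat all_cat pq lq aq /= xa [adj x.2 _]adj_sym yx y1 x2.
have [_ [/andP[_ ga] [g1 g2]]] := free_ends _ (connHr fg).
exists [:: f.2, f.1 & rcons q g.2]; split.
- by rewrite /is_walk /= adj_sym fa rcons_path pq lq.
- by move=> z; rewrite !inE => /orP[]/eqP ->; rewrite eqxx ?orbT.
- move=> z; rewrite !inE mem_rcons inE => /orP[]/eqP ->; last by rewrite eqxx !orbT.
  by have := mem_last f.1 q; rewrite lq inE => /orP[]->; rewrite ?orbT.
move=> z v zw; rewrite !inE => /orP[]/eqP ->;
  have /allP/(_ z zw)/andP[n1 n2] : all free [:: f.2, f.1 & rcons q g.2]
    by rewrite /= f1 f2 all_rcons g2 aq.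
- by [].
by [].
Qed.

Lemma odd_knot_cycle_asteroid s :
  odd_knot_cycle indep s -> uniq [seq m.1 | m <- s] ->
  exists (k : nat) (e : 'I_(k.*2.+1) -> {set V}), edge_asteroid adj X Y e.
Proof.
case: s => // x0 s' /andP[os cs] us; set s := x0 :: s' in os cs us.
have [k sz] : exists k, size s = k.*2.+1.
  exists (size s')./2; rewrite -[in LHS](odd_double_half (size s)) os /= uphalf_half.
  by move: os => /= /negbTE ->.
pose node i := nth x0 s (i %% size s).
have s_gt0 : 0 < size s by [].
have nodeK i : knot indep (node i) (node i.+1).
  have lt_i := ltn_pmod i s_gt0.
  have := (pathP x0) cs (i %% size s); rewrite size_rcons => /(_ lt_i).
  rewrite -[x0 :: rcons _ _]/(rcons s x0) nth_rcons lt_i -/(node i).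
  have -> : node i.+1 = nth x0 s ((i %% size s).+1 %% size s).
    by rewrite /node -(addn1 i) -(addn1 (i %% _)) modnDml.
  have le_i : i %% size s <= size s' by rewrite -ltnS.
  rewrite nth_rcons; case: ltngtP le_i => // [lt_i' _|E _].
    by rewrite [_.+1 %% _]modn_small.
  by rewrite E modnn.
have edge i : is_edge (node i).1 by case/andP: (nodeK i) => /connHl/and4P[].
have nbrs i : conn indep (node i.+1).1 (node i).1 (node i.+2).1.
  by case/andP: (nodeK i) (nodeK i.+1) => _ c1 /andP[c2 _]; apply: conn_trans c1 c2.
have node_mod i j : i = j %[mod size s] -> node i = node j by rewrite /node => ->.
(* Doubling indices puts [e (i + k)] and [e (i + k + 1)] at positions [2i - 1] and [2i + 1] modulo
   [2k + 1], next to [e i] on the cycle. *)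
exists k, (fun j => ends (node j.*2).1); split; last first.
  move=> i j /(ends_inj (edge _) (edge _)) E.
  have E2 : i.*2 = j.*2 %[mod size s].
    have lt_m t : t %% size s < size [seq m.1 | m <- s] by rewrite size_map ltn_pmod.
    apply/eqP; rewrite -(nth_uniq x0.1 (lt_m _) (lt_m _) us) !(nth_map x0) ?ltn_pmod //.
    by rewrite -/(node _) E.
  rewrite sz in E2; apply: val_inj => /=.
  (* Modulo [2k + 1], the inverse of 2 is [k + 1]. *)
  have half (t : 'I_(k.*2.+1)) : t.*2 * k.+1 = t %[mod k.*2.+1].
    by rewrite -(muln2 t) -mulnA mul2n doubleS mulnS addnC modnMDl.
  rewrite -(modn_small (ltn_ord i)) -(modn_small (ltn_ord j)) -half -[in RHS]half.
  by rewrite -modnMml E2 modnMml.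
split.
- case: k sz => // sz; case: (s) sz cs => // m [|//] _ /=.
  by rewrite andbT => /knot_neq; rewrite eqxx => /(_ indep_irr).
- by move=> i; apply/edgesP; exists (node i.*2).1.
move=> i; have [w [ww s1 s2 na]] := conn_walk (nbrs (i.*2 + k.*2)).
exists w; split=> //.
- have E : (inZp (i + k) : 'I_(k.*2.+1)).*2 = i.*2 + k.*2 %[mod size s].
    by rewrite sz -doubleD /= -(muln2 (_ %% _)) modnMml muln2.
  by rewrite (node_mod _ _ E).
- have E : (inZp (i + k + 1) : 'I_(k.*2.+1)).*2 = (i.*2 + k.*2).+2 %[mod size s].
    by rewrite sz -doubleD -doubleS -(addn1 (i + k)) /= -(muln2 (_ %% _)) modnMml muln2.
  by rewrite (node_mod _ _ E).
have E : i.*2 = (i.*2 + k.*2).+1 %[mod size s].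
  by rewrite sz -addnS modnDr.
by rewrite (node_mod _ _ E).
Qed.

End Bigraph.

Theorem theorem3p7 (V : finType) (adj : rel V) (X Y : {set V})
    (hG : bipartite_graph adj X Y) :
  [<-> cocomparability_bigraph adj X Y;
       exists M : mixed_graph V,
         [/\ complement_orientation adj X Y M, acyclic M & T_free adj X Y M];
       exists M : mixed_graph V,
         complement_orientation adj X Y M /\ T_free adj X Y M;
       ~ exists u v : V, invertible_pair adj X Y u v;
       ~ exists (k : nat) (e : 'I_(k.*2.+1) -> {set V}),
           weak_edge_asteroid adj X Y e;
       ~ exists (k : nat) (e : 'I_(k.*2.+1) -> {set V}),
           edge_asteroid adj X Y e;
       comparability_graph (edge_graph adj X Y)].
Proof.
have [symI irrI] := (@indep_sym V adj X, @indep_irr V adj X).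
(* Serves for (vii) to (i), and for (vi) to (vii), which passes through (i). *)
have from_no_cycle : (forall s, ~~ odd_knot_cycle (indep adj X) s) ->
    cocomparability_bigraph adj X Y.
  move=> nocycle; apply: (no_reversal_cocomparability hG) => u v uv suv.
  apply/negP => /(reversal_odd_knot_cycle hG uv suv) [s].
  exact/negP.
tfae.
- exact: cocomparability_orientation.
- by case=> M [cM _ tM]; exists M.
- by case=> M [cM tM] [u [v]]; apply: T_free_no_invertible_pair cM tM.
(* This implication, too, passes through (i). *)
- move=> ninv [k [e]]; apply: (cocomparability_no_weak_edge_asteroid hG).
  apply: (no_reversal_cocomparability hG) => u v uv suv; apply/negP => c.
  by apply: ninv; exists u, v; apply/(invertible_pairP hG).
- by move=> nweak [k [e [we _]]]; apply: nweak; exists k, e.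
- move=> nast; apply: (cocomparability_comparability hG); apply: from_no_cycle => s.
  apply/negP => /(odd_knot_cycle_uniq symI irrI)[s' os' us'].
  exact: nast (odd_knot_cycle_asteroid hG os' us').
move/(comparability_pairs hG) => comp; apply: from_no_cycle => s.
exact: transitive_orientation_no_odd_knot_cycle.
Qed.
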